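(* Let $\beta\in\{1,2,4\}$ and $n\ge1$. Every Bernoulli ensemble on $\mathbb{H}_{n,\beta}$ is a Meixner ensemble with parameters $A=-1$, $B=2$, $C=0$.
   Context: For $\beta=1,2,4$, $\mathbb{H}_{n,\beta}$ is the real vector space of $n\times n$ real symmetric, complex Hermitian, respectively quaternionic Hermitian matrices; $\mathcal{K}_{n,\beta}$ is $O(n)$, $U(n)$, $Sp(n)$ (quaternionic unitary matrices) respectively. A law $\mu$ on $\mathbb{H}_{n,\beta}$ is rotation invariant if $U\mathbf XU^*\sim\mathbf X$ for all $U\in\mathcal{K}_{n,\beta}$ when $\mathbf X\sim\mu$. $\mu$ is a Meixner ensemble with parameters $A,B,C\in\mathbb R$ if it is rotation invariant, has finite second moments, and for $\mathbf X,\mathbf Y$ independent with law $\mu$ and $\mathbf S=\mathbf X+\mathbf Y$ one has $\mathbb{E}((\mathbf X-\mathbf Y)^2|\mathbf S)=A\mathbf S^2+B\mathbf S+C\mathbf I_n$. Let $\mathbf I_{m,n}$ be the $n\times n$ diagonal matrix with $m$ ones followed by $n-m$ zeros and let $\mu_m$ be the law of $\mathbf U\mathbf I_{m,n}\mathbf U^*$ with $\mathbf U$ Haar distributed on $\mathcal{K}_{n,\beta}$. The Bernoulli ensemble with parameters $q_1,\dots,q_n\ge0$, $q_1+\dots+q_n\le1$, is the law $q_0\delta_{\mathbf 0}+q_1\mu_1+\dots+q_{n-1}\mu_{n-1}+q_n\delta_{\mathbf I_n}$ with $q_0=1-(q_1+\dots+q_n)$. *)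

(* Defs.v *)
From HB Require Import structures.
From mathcomp Require Import all_boot all_order all_algebra.
From mathcomp Require Import all_classical all_reals all_analysis.
From mathcomp Require Import complex.
From mathcomp Require Import ring.
Import Order.TTheory GRing.Theory Num.Theory.
Import numFieldNormedType.Exports.

Set Implicit Arguments.
Unset Strict Implicit.
Unset Printing Implicit Defensive.

Local Open Scope classical_set_scope.
Local Open Scope ring_scope.

(* The common interface of the scalars R, C and H: a ring with a conjugation,
   a central copy of R and real coordinates in an orthonormal basis.  All the
   definitions below are made over this interface and are then specialized to
   the three instances through [scalars]. *)
HB.mixin Record NzRing_isStarAlgebra (R : realType) K of GRing.NzRing K := {
  sconj : K -> K ;
  sconjD : {morph sconj : x y / x + y} ;
  sconjM : forall x y, sconj (x * y) = sconj y * sconj x ;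
  sconjK : involutive sconj ;
  sreal : R -> K ;
  sreal1 : sreal 1 = 1 ;
  srealD : {morph sreal : a b / a + b} ;
  srealM : {morph sreal : a b / a * b} ;
  sreal_comm : forall a x, sreal a * x = x * sreal a ;
  sconj_real : forall a, sconj (sreal a) = sreal a ;
  sdim : nat ;
  sbasis : 'I_sdim -> K ;
  scoord : 'I_sdim -> K -> R ;
  scoordD : forall k, {morph scoord k : x y / x + y} ;
  scoordZ : forall k a x, scoord k (sreal a * x) = a * scoord k x ;
  scoord_basis : forall k l, scoord k (sbasis l) = (k == l)%:R ;
  sbasisE : forall x, x = \sum_k sreal (scoord k x) * sbasis k ;
  snormE : forall x, x * sconj x = sreal (\sum_k scoord k x ^+ 2)
}.

#[short(type="starAlgType")]
HB.structure Definition StarAlgebra (R : realType) :=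
  {K of NzRing_isStarAlgebra R K & GRing.NzRing K}.

Section RealScalars.
Context (R : realType).

Fact real_sbasisE (x : R) : x = \sum_(k < 1) x * 1.
Proof. by rewrite big_ord1 mulr1. Qed.

Fact real_snormE (x : R) : x * x = \sum_(k < 1) x ^+ 2.
Proof. by rewrite big_ord1 expr2. Qed.

Fact real_scoord_basis (k l : 'I_1) : 1 = (k == l)%:R :> R.
Proof. by rewrite !ord1 eqxx. Qed.

HB.instance Definition _ := @NzRing_isStarAlgebra.Build R R^o
  (fun x => x) (fun _ _ => erefl) (@mulrC R) (fun=> erefl)
  (fun a => a) erefl (fun _ _ => erefl) (fun _ _ => erefl)
  (@mulrC R) (fun=> erefl)
  1 (fun=> 1) (fun _ x => x) (fun _ _ _ => erefl) (fun _ _ _ => erefl)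
  real_scoord_basis real_sbasisE real_snormE.

End RealScalars.

Section ComplexScalars.
Context (R : realType).
Local Notation C := (R[i]).

Local Notation conj := (@conjc R).
Local Notation real := (real_complex R).
Let basis (k : 'I_2) : C :=
  if k == 0 :> nat then Complex 1 0 else Complex 0 1.
Let coord (k : 'I_2) (z : C) : R :=
  if k == 0 :> nat then complex.Re z else complex.Im z.

Let mulE (a b c d : R) : Complex a b * Complex c d =
  Complex (a * c - b * d) (a * d + b * c).
Proof. by []. Qed.
Let addE (a b c d : R) : Complex a b + Complex c d =
  Complex (a + c) (b + d).
Proof. by []. Qed.

Fact complex_sconjD : {morph conj : x y / x + y}.
Proof. by move=> [a b] [c d]; rewrite addE /= opprD. Qed.

Fact complex_sconjM x y : conj (x * y) = conj y * conj x.
Proof. by rewrite rmorphM mulrC. Qed.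

Fact complex_sconjK : involutive conj.
Proof. exact: conjcK. Qed.

Fact complex_srealD : {morph real : a b / a + b}.
Proof. by move=> a b; rewrite addE addr0. Qed.

Fact complex_srealM : {morph real : a b / a * b}.
Proof. by move=> a b; rewrite mulE; congr Complex; ring. Qed.

Fact complex_sconj_real a : conj (real a) = real a.
Proof. by rewrite /= oppr0. Qed.

Fact complex_scoordD k : {morph coord k : x y / x + y}.
Proof. by move=> [a b] [c d]; rewrite addE /coord /=; case: ifP. Qed.

Fact complex_scoordZ k a x : coord k (real a * x) = a * coord k x.
Proof. by case: x => b c; rewrite mulE /coord /=; case: ifP => _; ring. Qed.

Fact complex_scoord_basis k l : coord k (basis l) = (k == l)%:R.
Proof. by case: k l => [[|[|k]] hk] [[|[|l]] hl]. Qed.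

Fact complex_sbasisE x : x = \sum_k real (coord k x) * basis k.
Proof.
case: x => a b; rewrite !big_ord_recl big_ord0 /coord /basis /= addr0 !mulE.
by rewrite addE; congr Complex; ring.
Qed.

Fact complex_snormE x : x * conj x = real (\sum_k coord k x ^+ 2).
Proof.
case: x => a b; rewrite !big_ord_recl big_ord0 /coord /= mulE.
by congr Complex; ring.
Qed.

HB.instance Definition _ := @NzRing_isStarAlgebra.Build R C
  conj complex_sconjD complex_sconjM complex_sconjK
  real erefl complex_srealD complex_srealM (fun=> mulrC _) complex_sconj_real
  2 basis coord complex_scoordD complex_scoordZ
  complex_scoord_basis complex_sbasisE complex_snormE.

End ComplexScalars.

Record quaternion (R : Type) : Type :=
  Quaternion { qre : R ; qi : R ; qj : R ; qk : R }.

Section QuaternionRing.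
Context (R : realType).
Local Notation H := (quaternion R).

Let encode (x : H) := (qre x, qi x, qj x, qk x).
Let decode (t : R * R * R * R) : H :=
  let: (a, b, c, d) := t in Quaternion a b c d.
Let encodeK : cancel encode decode. Proof. by case. Qed.

HB.instance Definition _ := Choice.copy H (can_type encodeK).

Definition qzero : H := Quaternion 0 0 0 0.
Definition qone : H := Quaternion 1 0 0 0.
Definition qopp (x : H) : H :=
  Quaternion (- qre x) (- qi x) (- qj x) (- qk x).
Definition qadd (x y : H) : H :=
  Quaternion (qre x + qre y) (qi x + qi y) (qj x + qj y) (qk x + qk y).
Definition qmul (x y : H) : H :=
  Quaternion
    (qre x * qre y - qi x * qi y - qj x * qj y - qk x * qk y)
    (qre x * qi y + qi x * qre y + qj x * qk y - qk x * qj y)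
    (qre x * qj y - qi x * qk y + qj x * qre y + qk x * qi y)
    (qre x * qk y + qi x * qj y - qj x * qi y + qk x * qre y).
Definition qconj (x : H) : H := Quaternion (qre x) (- qi x) (- qj x) (- qk x).
Definition qreal (a : R) : H := Quaternion a 0 0 0.
Definition qcoord (k : 'I_4) (x : H) : R :=
  [:: qre x; qi x; qj x; qk x]`_k.
Definition qbasis (k : 'I_4) : H :=
  nth qzero [:: Quaternion 1 0 0 0; Quaternion 0 1 0 0;
                Quaternion 0 0 1 0; Quaternion 0 0 0 1] k.

Fact qaddA : associative qadd.
Proof. by move=> x y z; congr Quaternion => /=; ring. Qed.
Fact qaddC : commutative qadd.
Proof. by move=> x y; congr Quaternion => /=; ring. Qed.
Fact qadd0 : left_id qzero qadd.
Proof. by case=> a b c d; rewrite /qadd /= !add0r. Qed.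
Fact qaddN : left_inverse qzero qopp qadd.
Proof. by move=> x; congr Quaternion => /=; ring. Qed.
HB.instance Definition _ := GRing.isZmodule.Build H qaddA qaddC qadd0 qaddN.

Fact qmulA : associative qmul.
Proof. by move=> x y z; congr Quaternion => /=; ring. Qed.
Fact qmul1l : left_id qone qmul.
Proof. by case=> a b c d; congr Quaternion => /=; ring. Qed.
Fact qmul1r : right_id qone qmul.
Proof. by case=> a b c d; congr Quaternion => /=; ring. Qed.
Fact qmulDl : left_distributive qmul qadd.
Proof. by move=> x y z; congr Quaternion => /=; ring. Qed.
Fact qmulDr : right_distributive qmul qadd.
Proof. by move=> x y z; congr Quaternion => /=; ring. Qed.
Fact qone_neq0 : qone != 0.
Proof. by apply/eqP => -[] /eqP; rewrite oner_eq0. Qed.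
HB.instance Definition _ := GRing.Zmodule_isNzRing.Build H
  qmulA qmul1l qmul1r qmulDl qmulDr qone_neq0.

Let qaddE (x y : H) : x + y = qadd x y. Proof. by []. Qed.
Let qmulE (x y : H) : x * y = qmul x y. Proof. by []. Qed.

Fact qconjD : {morph qconj : x y / x + y}.
Proof. by move=> x y; congr Quaternion => /=; ring. Qed.
Fact qconjM x y : qconj (x * y) = qconj y * qconj x.
Proof. by congr Quaternion => /=; ring. Qed.
Fact qconjK : involutive qconj.
Proof. by case=> a b c d; rewrite /qconj /= !opprK. Qed.
Fact qrealD : {morph qreal : a b / a + b}.
Proof. by move=> a b; congr Quaternion => /=; ring. Qed.
Fact qrealM : {morph qreal : a b / a * b}.
Proof. by move=> a b; congr Quaternion => /=; ring. Qed.
Fact qreal_comm a x : qreal a * x = x * qreal a.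
Proof. by congr Quaternion => /=; ring. Qed.
Fact qconj_real a : qconj (qreal a) = qreal a.
Proof. by rewrite /qconj /qreal /= !oppr0. Qed.
Fact qcoordD k : {morph qcoord k : x y / x + y}.
Proof. by case: k => [[|[|[|[|k]]]] hk]. Qed.
Fact qcoordZ k a x : qcoord k (qreal a * x) = a * qcoord k x.
Proof.
by case: k => [[|[|[|[|k]]]] hk]; rewrite qmulE /qcoord //=; ring.
Qed.
Fact qcoord_basis k l : qcoord k (qbasis l) = (k == l)%:R.
Proof.
by case: k l => [[|[|[|[|k]]]] hk] [[|[|[|[|l]]]] hl].
Qed.
Fact qbasisE x : x = \sum_k qreal (qcoord k x) * qbasis k.
Proof.
rewrite !big_ord_recl big_ord0 addr0 /qcoord /qbasis /= !qaddE !qmulE.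
by case: x => a b c d; congr Quaternion => /=; ring.
Qed.
Fact qnormE x : x * qconj x = qreal (\sum_k qcoord k x ^+ 2).
Proof.
rewrite !big_ord_recl big_ord0 addr0 /qcoord /= qmulE.
by congr Quaternion => /=; ring.
Qed.

HB.instance Definition _ := @NzRing_isStarAlgebra.Build R H
  qconj qconjD qconjM qconjK qreal erefl qrealD qrealM qreal_comm qconj_real
  4 qbasis qcoord qcoordD qcoordZ qcoord_basis qbasisE qnormE.

End QuaternionRing.

Inductive dyson_index := beta1 | beta2 | beta4.

Definition scalars (R : realType) (beta : dyson_index) : starAlgType R :=
  match beta with
  | beta1 => R^o
  | beta2 => R[i]
  | beta4 => quaternion R
  end.

Section Matrices.
Context (R : realType) (K : starAlgType R).

Definition adjmx m n (A : 'M[K]_(m, n)) : 'M[K]_(n, m) :=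
  \matrix_(i, j) sconj (A j i).

Lemma sconj0 : sconj (0 : K) = 0.
Proof. by apply: (addrI (sconj 0)); rewrite -sconjD !addr0. Qed.

Lemma sconj1 : sconj (1 : K) = 1.
Proof. by rewrite -[LHS]mulr1 -[X in _ * X]sconjK -sconjM mulr1 sconjK. Qed.

Lemma sconj_sum I (r : seq I) (F : I -> K) :
  sconj (\sum_(i <- r) F i) = \sum_(i <- r) sconj (F i).
Proof. by apply: big_morph; [exact: sconjD|exact: sconj0]. Qed.

Lemma adjmxK m n : cancel (@adjmx m n) (@adjmx n m).
Proof. by move=> A; apply/matrixP => i j; rewrite !mxE sconjK. Qed.

Lemma adjmxM m n p (A : 'M[K]_(m, n)) (B : 'M[K]_(n, p)) :
  adjmx (A *m B) = adjmx B *m adjmx A.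
Proof.
apply/matrixP => i j; rewrite !mxE sconj_sum; apply: eq_bigr => k _.
by rewrite sconjM !mxE.
Qed.

Lemma adjmxD m n (A B : 'M[K]_(m, n)) : adjmx (A + B) = adjmx A + adjmx B.
Proof. by apply/matrixP => i j; rewrite !mxE sconjD. Qed.

Lemma adjmx0 m n : adjmx (0 : 'M[K]_(m, n)) = 0.
Proof. by apply/matrixP => i j; rewrite !mxE sconj0. Qed.

Lemma adjmxN m n (A : 'M[K]_(m, n)) : adjmx (- A) = - adjmx A.
Proof. by apply: (addrI (adjmx A)); rewrite -adjmxD !subrr adjmx0. Qed.

Context (n : nat).

Definition is_herm : {pred 'M[K]_n} := fun A => adjmx A == A.

Lemma is_herm_zmod_closed : zmod_closed is_herm.
Proof.
split=> [|A B /eqP hA /eqP hB]; first by rewrite unfold_in adjmx0.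
by rewrite unfold_in /is_herm adjmxD adjmxN hA hB.
Qed.

HB.instance Definition _ := GRing.isZmodClosed.Build _ is_herm
  is_herm_zmod_closed.

Record herm := Herm { herm_val :> 'M[K]_n ; hermP : herm_val \in is_herm }.

HB.instance Definition _ := [isSub for herm_val].
HB.instance Definition _ := [Choice of herm by <:].
HB.instance Definition _ := [SubChoice_isSubZmodule of herm by <:].
HB.instance Definition _ := isPointed.Build herm 0.

Definition is_unitary : {pred 'M[K]_n} :=
  fun U => (U *m adjmx U == 1%:M) && (adjmx U *m U == 1%:M).

Record unitary :=
  Unitary { unitary_val :> 'M[K]_n ; unitaryP : unitary_val \in is_unitary }.

HB.instance Definition _ := [isSub for unitary_val].
HB.instance Definition _ := [Choice of unitary by <:].

Lemma adjmx1 : adjmx 1%:M = 1%:M :> 'M[K]_n.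
Proof.
apply/matrixP => i j; rewrite !mxE eq_sym.
by case: eqP => _; rewrite ?sconj0 ?sconj1.
Qed.

Fact unitary1_subproof : 1%:M \in is_unitary.
Proof. by rewrite unfold_in /is_unitary adjmx1 mulmx1 eqxx. Qed.
Definition unitary1 : unitary := Unitary unitary1_subproof.

HB.instance Definition _ := isPointed.Build unitary unitary1.

Fact unitary_mul_subproof (U V : unitary) :
  (U : 'M[K]_n) *m V \in is_unitary.
Proof.
case: U V => U hU [V hV] /=; move: hU hV; rewrite !unfold_in /is_unitary.
move=> /andP[/eqP U1 /eqP U2] /andP[/eqP V1 /eqP V2]; rewrite adjmxM.
rewrite -mulmxA (mulmxA V) V1 mul1mx U1 eqxx /=.
by rewrite -mulmxA (mulmxA (adjmx U)) U2 mul1mx V2.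
Qed.
Definition unitary_mul (U V : unitary) : unitary :=
  Unitary (unitary_mul_subproof U V).

Fact rotate_subproof (U : unitary) (X : herm) :
  (U : 'M[K]_n) *m X *m adjmx U \in is_herm.
Proof.
case: X => X hX /=; move: hX; rewrite !unfold_in /is_herm => /eqP hX.
by rewrite !adjmxM adjmxK hX mulmxA.
Qed.
Definition rotate (U : unitary) (X : herm) : herm :=
  Herm (rotate_subproof U X).

Fact Imn_subproof (m : nat) :
  (\matrix_(i, j) ((i == j) && (i < m)%N)%:R : 'M[K]_n) \in is_herm.
Proof.
rewrite unfold_in; apply/eqP/matrixP => i j; rewrite !mxE eq_sym.
by case: eqP => [->|_]; [case: ltnP => _ /=; rewrite ?sconj0 ?sconj1|rewrite sconj0].
Qed.
Definition Imn (m : nat) : herm := Herm (Imn_subproof m).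

(* The Borel sets of the finite-dimensional real vector space 'M[K]_n are
   generated by the real coordinates of the entries. *)
Definition mx_coord (i j : 'I_n) (k : 'I_(@sdim R K)) (A : 'M[K]_n) : R :=
  scoord k (A i j).

Definition mx_borel : set (set 'M[K]_n) :=
  <<s [set C | exists i j k, exists2 B, measurable B & C = mx_coord i j k @^-1` B] >>.

Lemma sigma_algebra_mx_borel : sigma_algebra setT mx_borel.
Proof. exact: smallest_sigma_algebra. Qed.

Section Trace.
Context (T : pointedType) (f : T -> 'M[K]_n).
Let G : set (set T) := preimage_set_system setT f mx_borel.
Let sG : sigma_algebra setT G.
Proof. exact/sigma_algebra_preimage/sigma_algebra_mx_borel. Qed.
Fact trace_borel0 : G set0. Proof. by case: sG. Qed.
Fact trace_borelC A : G A -> G (~` A).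
Proof. by case: sG => _ h _ /h; rewrite setTD. Qed.
Fact trace_borelU (F : (set T)^nat) :
  (forall i, G (F i)) -> G (\bigcup_i F i).
Proof. by case: sG => _ _; exact. Qed.
End Trace.

HB.instance Definition _ := @isMeasurable.Build default_measure_display herm
  (preimage_set_system setT herm_val mx_borel)
  (@trace_borel0 herm herm_val) (@trace_borelC herm herm_val)
  (@trace_borelU herm herm_val).

HB.instance Definition _ := @isMeasurable.Build default_measure_display unitary
  (preimage_set_system setT unitary_val mx_borel)
  (@trace_borel0 unitary unitary_val) (@trace_borelC unitary unitary_val)
  (@trace_borelU unitary unitary_val).

End Matrices.

Section Probability.
Context d (Omega : measurableType d) (R : realType) (P : probability Omega R).

Definition has_law d' (T : measurableType d') (X : {RV P >-> T})
    (mu : probability T R) : Prop :=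
  forall A, measurable A -> distribution P X A = mu A.

Definition independent_RV d1 d2 (T1 : measurableType d1)
    (T2 : measurableType d2) (X : {RV P >-> T1}) (Y : {RV P >-> T2}) : Prop :=
  forall A B, measurable A -> measurable B ->
    P (X @^-1` A `&` Y @^-1` B) = (P (X @^-1` A) * P (Y @^-1` B))%E.

(* W is a version of E(Z | S). *)
Definition is_cond_exp d' (T : measurableType d') (S : Omega -> T)
    (Z W : Omega -> R) : Prop :=
  [/\ measurable_fun setT S,
      P.-integrable setT (EFin \o Z),
      P.-integrable setT (EFin \o W),
      measurable_fun setT (W : g_sigma_algebra_preimageType S -> R) &
      forall A, g_sigma_algebra_preimage S A ->
        (\int[P]_(w in A) (W w)%:E = \int[P]_(w in A) (Z w)%:E)%E].

Definition is_cond_exp_mx (K : starAlgType R) n d' (T : measurableType d')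
    (S : Omega -> T) (Z W : Omega -> 'M[K]_n) : Prop :=
  forall i j k, is_cond_exp S (mx_coord i j k \o Z) (mx_coord i j k \o W).

End Probability.

Section Ensembles.
Context (R : realType) (K : starAlgType R) (n : nat).
Implicit Type mu : probability (herm K n) R.

Definition rotation_invariant mu : Prop :=
  forall (U : unitary K n) A, measurable A -> pushforward mu (rotate U) A = mu A.

(* The integrand is the squared Frobenius norm, [mx_coord] being orthonormal. *)
Definition finite_second_moments mu : Prop :=
  (\int[mu]_X (\sum_i \sum_j \sum_k mx_coord i j k X ^+ 2)%:E < +oo)%E.

(* [sreal a *: M] scales every entry by the real number a; the conditional
   expectation of a matrix is taken in each real coordinate of each entry. *)
Definition meixner_ensemble (A B C : R) mu : Prop :=
  [/\ rotation_invariant mu, finite_second_moments mu &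
    forall d (Omega : measurableType d) (P : probability Omega R)
        (X Y : {RV P >-> herm K n}),
      has_law X mu -> has_law Y mu -> independent_RV X Y ->
      let S w : herm K n := X w + Y w in
      let D w : herm K n := X w - Y w in
      is_cond_exp_mx P S (fun w => D w *m D w)
        (fun w => sreal A *: (S w *m S w) + sreal B *: (S w : 'M[K]_n)
                  + (sreal C)%:M)].

(* On the compact group of unitary matrices a left invariant probability
   exists, is unique, and is also right invariant. *)
Definition is_haar (h : probability (unitary K n) R) : Prop :=
  forall (U : unitary K n) A, measurable A ->
    pushforward h (unitary_mul U) A = h A.

(* Only q 1, ..., q n are used. *)
Definition bernoulli_ensemble (q : nat -> R) mu : Prop :=
  [/\ forall m, (1 <= m <= n)%N -> 0 <= q m,
      \sum_(1 <= m < n.+1) q m <= 1 &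
      exists2 h : probability (unitary K n) R, is_haar h &
        forall A, measurable A ->
          mu A = ((1 - \sum_(1 <= m < n.+1) q m)%:E * \d_(0%R : herm K n) A
            + \sum_(1 <= m < n) (q m)%:E
                * pushforward h (fun U => rotate U (Imn K n m)) A
            + (q n)%:E * \d_(Imn K n n) A)%E].

End Ensembles.

(* Main.v *)
(* Almost surely a Bernoulli ensemble is an orthogonal projection.  If
   X ^ 2 = X and Y ^ 2 = Y then (X - Y) ^ 2 = - (X + Y) ^ 2 + 2 (X + Y), so
   the conditioned variable is almost surely equal to a function of S. *)
Require Import Defs.
From mathcomp Require Import all_boot all_order all_algebra.
From mathcomp Require Import all_classical all_reals all_analysis.
From mathcomp Require Import measurable_realfun.
Import Order.TTheory GRing.Theory Num.Theory.

Set Implicit Arguments.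
Unset Strict Implicit.
Unset Printing Implicit Defensive.

Local Open Scope classical_set_scope.
Local Open Scope ring_scope.

(** * Measurable real functions that are bounded on a given set *)

Section Tame.
Context d (T : measurableType d) (R : realType) (E : set T).
Implicit Types f g : T -> R.

(* With E = set0 only measurability remains, so that the closure lemmas below
   serve both for measurability and for integrability. *)
Definition tame f :=
  measurable_fun setT f /\ exists c, forall x, E x -> `|f x| <= c.

Lemma tame_cst a : tame (fun=> a).
Proof. by split; [exact: measurable_cst | exists `|a|]. Qed.

Lemma tameD f g : tame f -> tame g -> tame (fun x => f x + g x).
Proof.
move=> [mf [a fa]] [mg [b gb]]; split; first exact: measurable_funD.
exists (a + b) => x Ex; apply: (le_trans (ler_normD _ _)).
by apply: lerD; [exact: fa | exact: gb].
Qed.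

Lemma tameM f g : tame f -> tame g -> tame (fun x => f x * g x).
Proof.
move=> [mf [a fa]] [mg [b gb]]; split; first exact: measurable_funM.
exists (a * b) => x Ex; rewrite normrM.
by apply: ler_pM => //; [exact: fa | exact: gb].
Qed.

Lemma tame_sum (I : Type) (r : seq I) (F : I -> T -> R) :
  (forall i, tame (F i)) -> tame (fun x => \sum_(i <- r) F i x).
Proof.
move=> tF; elim: r => [|i r IH].
  by under eq_fun do rewrite big_nil; exact: tame_cst.
by under eq_fun do rewrite big_cons; exact: tameD.
Qed.

(** The complement of [E] is negligible, so only the integral over [E] matters, and there a bounded
    measurable function is integrable against a finite measure. *)
Lemma tame_integrable (P : probability T R) f :
  measurable E -> P (~` E) = 0 -> tame f -> P.-integrable setT (EFin \o f).
Proof.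
move=> mE PE [mf [c fc]].
apply/(negligible_integrable (measurableC mE) measurableT _ PE).
  exact/measurable_EFinP.
rewrite setTD setCK; apply: measurable_bounded_integrable => //.
- by rewrite (le_lt_trans (probability_le1 P mE)) ?ltry.
- exact: measurable_funTS.
- exists c; split; first exact: num_real.
  by move=> b cb x Ex; exact: le_trans (fc x Ex) (ltW cb).
Qed.

End Tame.

(** * Real coordinates of products and conjugates of scalars *)

Section StarAlgebraTheory.
Context (R : realType) (K : starAlgType R).

Lemma sreal0 : sreal 0 = 0 :> K.
Proof. by apply: (addrI (sreal 0)); rewrite -srealD !addr0. Qed.

Lemma srealN a : sreal (- a) = - sreal a :> K.
Proof. by apply: (addrI (sreal a)); rewrite -srealD !subrr sreal0. Qed.

(** A nonzero a - b sent to 0 would give 1 = [sreal] (a - b) * [sreal] (1 / (a - b)) = 0 in a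
    nontrivial ring. *)
Lemma sreal_inj : injective (@sreal R K).
Proof.
move=> a b /eqP; rewrite -subr_eq0 -srealN -srealD => /eqP ab0.
apply/eqP; rewrite -subr_eq0; apply/eqP/eqP; apply: contraTT isT => ab.
have /eqP := @sreal1 R K.
by rewrite -(mulfV ab) srealM ab0 mul0r eq_sym oner_eq0.
Qed.

Lemma scoord0 k : scoord k (0 : K) = 0 :> R.
Proof. by apply: (addrI (scoord k (0 : K))); rewrite -scoordD !addr0. Qed.

Lemma scoord_sum k I (r : seq I) (F : I -> K) :
  scoord k (\sum_(i <- r) F i) = \sum_(i <- r) scoord k (F i).
Proof. by apply: big_morph; [exact: scoordD | exact: scoord0]. Qed.

(** Expanding both factors in the basis shows multiplication to be bilinear over the reals, with
    structure constants [scoord k (sbasis l * sbasis m)]. Products of matrices are thereby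
    polynomial in real coordinates. *)
Lemma scoordM k (x y : K) : scoord k (x * y) =
  \sum_l \sum_m scoord l x * scoord m y * scoord k (sbasis l * sbasis m : K).
Proof.
rewrite {1}(sbasisE x) mulr_suml scoord_sum; apply: eq_bigr => l _.
rewrite {1}(sbasisE y) mulr_sumr scoord_sum; apply: eq_bigr => m _.
rewrite mulrA -(mulrA _ (sbasis l)) -(sreal_comm _ (sbasis l)) !mulrA.
by rewrite -srealM -!mulrA scoordZ mulrA.
Qed.

Lemma scoord_sconj k (x : K) :
  scoord k (sconj x) = \sum_l scoord l x * scoord k (sconj (sbasis l : K)).
Proof.
rewrite {1}(sbasisE x) sconj_sum scoord_sum; apply: eq_bigr => l _.
by rewrite sconjM sconj_real -sreal_comm scoordZ.
Qed.

End StarAlgebraTheory.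

(** * Matrix-valued functions with tame coordinates *)

Section TameMatrices.
Context d (T : measurableType d) (R : realType) (K : starAlgType R) (n : nat).
Context (E : set T).
Implicit Types f g : T -> 'M[K]_n.

Definition mxtame f := forall i j k, tame E (mx_coord i j k \o f).

Lemma mxtame_cst A : mxtame (fun=> A).
Proof. by move=> i j k; exact: tame_cst. Qed.

Lemma mxtameD f g : mxtame f -> mxtame g -> mxtame (fun x => f x + g x).
Proof.
move=> tf tg i j k; rewrite /comp /mx_coord.
under eq_fun do rewrite !mxE scoordD.
exact: (tameD (tf i j k) (tg i j k)).
Qed.

Lemma mxtameZ a f : mxtame f -> mxtame (fun x => sreal a *: f x).
Proof.
move=> tf i j k; rewrite /comp /mx_coord.
under eq_fun do rewrite !mxE scoordZ.
exact: (tameM (tame_cst _ _) (tf i j k)).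
Qed.

Lemma mxtameN f : mxtame f -> mxtame (fun x => - f x).
Proof.
move=> /(mxtameZ (-1)); under eq_fun do rewrite srealN sreal1 scaleN1r.
exact.
Qed.

Lemma mxtameM f g : mxtame f -> mxtame g -> mxtame (fun x => f x *m g x).
Proof.
move=> tf tg i j k; rewrite /comp /mx_coord.
under eq_fun do rewrite !mxE scoord_sum.
apply: tame_sum => l; under eq_fun do rewrite scoordM.
apply: tame_sum => a; apply: tame_sum => b.
apply: tameM (tame_cst _ _); exact: (tameM (tf _ _ _) (tg _ _ _)).
Qed.

Lemma mxtame_adj f : mxtame f -> mxtame (fun x => adjmx (f x)).
Proof.
move=> tf i j k; rewrite /comp /mx_coord.
under eq_fun do rewrite !mxE scoord_sconj.
apply: tame_sum => l; exact: (tameM (tf _ _ _) (tame_cst _ _)).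
Qed.

(** The sets with measurable preimage form a sigma-algebra, which contains the generators of
    [mx_borel]. *)
Lemma measurable_herm (f : T -> herm K n) :
  (forall i j k,
    measurable_fun setT (mx_coord i j k \o @herm_val R K n \o f)) ->
  measurable_fun setT f.
Proof.
move=> mf _ _ [B mB <-]; rewrite !setTI.
suff : @mx_borel R K n `<=`
    [set B | measurable (f @^-1` (@herm_val R K n @^-1` B))].
  exact.
apply: smallest_sub.
  split => [|A|F] /=.
  - by rewrite !preimage_set0.
  - by rewrite setTD => mA; exact: measurableC mA.
  - by move=> mF; exact: bigcupT_measurable mF.
move=> _ [i [j [k [C mC ->]]]] /=.
by have := mf i j k measurableT _ mC; rewrite setTI.
Qed.

End TameMatrices.

(** * Measurability of coordinates and of rotations *)

Section MeasurableCoordinates.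
Context (R : realType) (K : starAlgType R) (n : nat).

Let mx_coord_borel i j k (B : set R) : measurable B ->
  @mx_borel R K n (mx_coord i j k @^-1` B).
Proof. by move=> mB; apply: sub_sigma_algebra; exists i, j, k, B. Qed.

Lemma measurable_herm_coord i j k :
  measurable_fun setT (mx_coord i j k \o @herm_val R K n).
Proof.
move=> _ B mB; exists (mx_coord i j k @^-1` B); last by [].
exact: mx_coord_borel.
Qed.

Lemma measurable_unitary_coord i j k :
  measurable_fun setT (mx_coord i j k \o @unitary_val R K n).
Proof.
move=> _ B mB; exists (mx_coord i j k @^-1` B); last by [].
exact: mx_coord_borel.
Qed.

Lemma mxtame_set0 d (T : measurableType d) (f : T -> 'M[K]_n) :
  (forall i j k, measurable_fun setT (mx_coord i j k \o f)) -> mxtame set0 f.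
Proof. by move=> mf i j k; split; [exact: mf | exists 0]. Qed.

(** The coordinates of the rotated matrix are polynomials in those of X, so the closure lemmas over
    the empty set apply. *)
Lemma measurable_rotate (U : unitary K n) : measurable_fun setT (rotate U).
Proof.
apply: measurable_herm => i j k.
have th : mxtame set0 (@herm_val R K n).
  by apply: mxtame_set0; exact: measurable_herm_coord.
exact: (mxtameM (mxtameM (mxtame_cst _ _) th) (mxtame_cst _ _) i j k).1.
Qed.

Lemma measurable_rotate_orbit (X : herm K n) :
  measurable_fun setT (fun U : unitary K n => rotate U X).
Proof.
apply: measurable_herm => i j k.
have tu : mxtame set0 (@unitary_val R K n).
  by apply: mxtame_set0; exact: measurable_unitary_coord.
exact: (mxtameM (mxtameM tu (mxtame_cst _ _)) (mxtame_adj tu) i j k).1.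
Qed.

End MeasurableCoordinates.

(** * Orthogonal projections *)

Section Projections.
Context (R : realType) (K : starAlgType R) (n : nat).

(** Self-adjointness is built into [herm], so idempotence alone singles out the orthogonal
    projections. *)
Definition projections : set (herm K n) := [set X | X *m X = X :> 'M[K]_n].

(** This set is a finite intersection of zero sets of the real coordinates of X^2 - X. *)
Lemma measurable_projections : measurable projections.
Proof.
pose D (X : herm K n) : 'M[K]_n := X *m X - X.
have tD : mxtame set0 D.
  have th : mxtame set0 (@herm_val R K n).
    by apply: mxtame_set0; exact: measurable_herm_coord.
  by apply: mxtameD; [exact: mxtameM | exact: mxtameN].
have -> : projections = \bigcap_(t in [set: 'I_n * 'I_n * 'I_(@sdim R K)])
    ((mx_coord t.1.1 t.1.2 t.2 \o D) @^-1` [set 0]).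
  apply/seteqP; split => [X pX [[i j] k] _ | X DX].
    by rewrite /= /D pX subrr /mx_coord mxE scoord0.
  apply/eqP; rewrite -subr_eq0; apply/eqP/matrixP => i j.
  rewrite [LHS]sbasisE [RHS]mxE; apply: big1 => k _.
  by rewrite [scoord _ _](DX (i, j, k) I) sreal0 mul0r.
apply: fin_bigcap_measurable => [|[[i j] k] _]; first exact: finite_finset.
by have := (tD i j k).1 measurableT _ (measurable_set1 0); rewrite setTI.
Qed.

(** This uniform bound is the source of all integrability below: polynomials in the coordinates are
    bounded on projections. *)
Lemma projection_coord_le1 (X : herm K n) i j k :
  projections X -> `|mx_coord i j k X| <= 1.
Proof.
move=> pX; pose r (j : 'I_n) := \sum_k scoord k (X i j) ^+ 2.
have r0 l : 0 <= r l by apply: sumr_ge0 => ? _; exact: sqr_ge0.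
(* Idempotence and self-adjointness turn the diagonal entry into the sum of the products of X i l
   with its own conjugate. *)
have Xii : X i i = sreal (\sum_l r l) :> K.
  have XC l : X l i = sconj (X i l) :> K.
    by have /eqP/matrixP/(_ l i) := hermP X; rewrite mxE => <-.
  rewrite -{1}pX mxE (big_morph _ (@srealD R K) (sreal0 K)).
  by apply: eq_bigr => l _; rewrite XC snormE.
have rle l : r l <= \sum_l r l.
  by rewrite (bigD1 l) //= lerDl; apply: sumr_ge0.
(* Row i of X has square norm t = X i i, so t ^ 2 = |X i i| ^ 2 <= t. *)
have t_le1 : \sum_l r l <= 1.
  rewrite leNgt; apply/negP => t1.
  have := rle i; have -> : r i = (\sum_l r l) * (\sum_l r l).
    by apply: (@sreal_inj _ K); rewrite srealM -[LHS]snormE Xii sconj_real.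
  by rewrite leNgt ltr_pMr ?t1 //; exact: lt_trans ltr01 t1.
have ck : mx_coord i j k X ^+ 2 <= 1.
  apply: le_trans t_le1; apply: le_trans (rle j).
  by rewrite /r (bigD1 k) //= lerDl; apply: sumr_ge0 => ? _; exact: sqr_ge0.
by rewrite -(@expr_le1 _ 2) // real_normK ?num_real.
Qed.

Lemma projections_tame d (T : measurableType d) (E : set T)
    (X : T -> herm K n) :
  measurable_fun setT X -> E `<=` X @^-1` projections ->
  mxtame E (fun w => X w : 'M[K]_n).
Proof.
move=> mX EX i j k; split.
  exact: (measurableT_comp (@measurable_herm_coord R K n i j k) mX).
by exists 1 => w /EX; exact: projection_coord_le1.
Qed.

Lemma rotate_projection (U : unitary K n) X :
  projections X -> projections (rotate U X).
Proof.
rewrite /projections /= => pX.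
have /andP[_ /eqP UU] := unitaryP U.
by rewrite -!mulmxA (mulmxA (adjmx U) U) UU mul1mx (mulmxA X X) pX.
Qed.

Lemma Imn_projection m : projections (Imn K n m).
Proof.
apply/matrixP => i j; rewrite [LHS]mxE (bigD1 i) //= big1 => [|l /negPf li].
  by rewrite !mxE eqxx /= addr0; case: (i < m)%N; rewrite ?mul1r ?mul0r ?andbF.
by rewrite !mxE eq_sym li mul0r.
Qed.

Lemma projection0 : projections 0.
Proof. exact: mulmx0. Qed.

(** Both sides expand to X + Y - XY - YX; X and Y need not commute. *)
Lemma projections_sqrB (X Y : herm K n) : projections X -> projections Y ->
  ((X - Y : herm K n) : 'M[K]_n) *m (X - Y : herm K n) =
  sreal (-1) *: (((X + Y : herm K n) : 'M[K]_n) *m (X + Y : herm K n))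
  + sreal 2 *: ((X + Y : herm K n) : 'M[K]_n) + (sreal 0)%:M.
Proof.
rewrite /projections /= => pX pY.
rewrite sreal0 raddf0 addr0 srealN srealD sreal1 scaleN1r scalerDl !scale1r.
rewrite mulmxBl !mulmxBr mulmxDl !mulmxDr pX pY.
set x := herm_val X; set y := herm_val Y; set a := x *m y; set b := y *m x.
(* Each half of -(X + Y)^2 is paired with one of the two copies of x + y, leaving y - a and x -
   b. *)
rewrite [in RHS](opprD (x + a)) [RHS]addrACA.
have -> : - (x + a) + (x + y) = y - a.
  by rewrite opprD addrACA addNr add0r addrC.
have -> : - (b + y) + (x + y) = x - b.
  by rewrite opprD addrACA addNr addr0 addrC.
by rewrite opprB addrACA [RHS]addrACA (addrC x).
Qed.

End Projections.

(** * The Meixner property of Bernoulli ensembles *)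

Section Bernoulli.
Context (R : realType) (K : starAlgType R) (n : nat).
Context (q : nat -> R) (mu : probability (herm K n) R).
Hypothesis hmu : bernoulli_ensemble q mu.

(** Every component of the mixture lives on projections: 0, the identity, and the rotated copies of
    [Imn K n m]. *)
Lemma bernoulli_projections : mu (~` @projections R K n) = 0%E.
Proof.
have [_ _ [h _ muE]] := hmu.
have dirac0 X : projections X -> \d_X (~` @projections R K n) = 0%E :> \bar R.
  by move=> pX; rewrite diracE memNset.
rewrite muE; last exact/measurableC/measurable_projections.
rewrite (dirac0 _ (projection0 _ _)) (dirac0 _ (Imn_projection _ _ n)).
rewrite !mule0 add0e adde0 big1 // => m _.
rewrite /pushforward [X in h X](_ : _ = set0) ?measure0 ?mule0 //.
by rewrite -subset0 => U; apply; exact/rotate_projection/Imn_projection.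
Qed.

(** Each component is invariant: rotations fix 0 and the identity, and the orbit laws inherit the
    left invariance of Haar measure. *)
Lemma bernoulli_rotation_invariant : rotation_invariant mu.
Proof.
move=> U A mA; have [_ _ [h hh muE]] := hmu.
have mUA : measurable (rotate U @^-1` A).
  by have := measurable_rotate U measurableT mA; rewrite setTI.
rewrite /pushforward !muE //; congr (_ * _ + _ + _ * _)%E.
- suff e : rotate U 0 = 0.
    rewrite !diracE; congr (_%:R%:E); apply: congr1.
    by apply/idP/idP; rewrite !inE /= e.
  by apply: val_inj; rewrite /= mulmx0 mul0mx.
- apply: eq_bigr => m _; congr (_ * _)%E.
  have mV : measurable ((fun V : unitary K n => rotate V (Imn K n m)) @^-1` A).
    have := @measurable_rotate_orbit R K n (Imn K n m) measurableT _ mA.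
    by rewrite setTI.
  (* Rotating by the product UV amounts to rotating by V and then by U. *)
  apply: etrans (hh U _ mV); rewrite /pushforward; congr (h _).
  apply/seteqP; split => V /=; rewrite (_ : rotate (unitary_mul U V) _ =
    rotate U (rotate V (Imn K n m))) //; apply: val_inj => /=;
    by rewrite adjmxM !mulmxA.
- suff e : rotate U (Imn K n n) = Imn K n n.
    rewrite !diracE; congr (_%:R%:E); apply: congr1.
    by apply/idP/idP; rewrite !inE /= e.
  apply: val_inj => /=.
  (* Every index is below n, so [Imn K n n] is the identity. *)
  rewrite (_ : \matrix_(i, j) _ = 1%:M); last first.
    by apply/matrixP => i j; rewrite !mxE ltn_ord andbT.
  by rewrite mulmx1; have /andP[/eqP] := unitaryP U.
Qed.

(** The squared norm is bounded on projections, which carry all the mass. *)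
Lemma bernoulli_finite_second_moments : finite_second_moments mu.
Proof.
pose f (X : herm K n) := \sum_i \sum_j \sum_k mx_coord i j k X ^+ 2.
have tf : tame (@projections R K n) f.
  do 3![apply: tame_sum => ?]; under eq_fun do rewrite expr2.
  have tX := @projections_tame R K n _ _ _ idfun (@measurable_id _ _ _)
    (@subset_refl _ (@projections R K n)).
  by apply: tameM; exact: tX.
have /integrableP[_] := tame_integrable (@measurable_projections R K n)
  bernoulli_projections tf.
congr (_ < _)%E; apply: eq_integral => X _; rewrite /= ger0_norm //.
by do 3![apply: sumr_ge0 => ? _]; exact: sqr_ge0.
Qed.

(** Almost surely the squared difference equals a polynomial in S, which is measurable with respect
    to S and hence is a version of the conditional expectation. *)
Lemma bernoulli_meixner : meixner_ensemble (-1) 2 0 mu.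
Proof.
split; [exact: bernoulli_rotation_invariant
  | exact: bernoulli_finite_second_moments |].
move=> d Omega P X Y lX lY _ S D.
pose p := @projections R K n.
pose E := X @^-1` p `&` Y @^-1` p.
have mp : measurable p by exact: measurable_projections.
have mX : measurable_fun setT X by exact: measurable_funPT.
have mY : measurable_fun setT Y by exact: measurable_funPT.
have mXp : measurable (X @^-1` p) by have := mX measurableT _ mp; rewrite setTI.
have mYp : measurable (Y @^-1` p) by have := mY measurableT _ mp; rewrite setTI.
have mE : measurable E by exact: measurableI.
have PE : P (~` E) = 0%E.
  rewrite setCI; apply: null_set_setU; [exact: measurableC
    | exact: measurableC | |]; rewrite preimage_setC.
    by rewrite -bernoulli_projections -lX //; exact: measurableC.
  by rewrite -bernoulli_projections -lY //; exact: measurableC.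
have tX : mxtame E (fun w => X w : 'M[K]_n).
  by apply: projections_tame => // w [].
have tY : mxtame E (fun w => Y w : 'M[K]_n).
  by apply: projections_tame => // w [].
have tS : mxtame E (fun w => S w : 'M[K]_n) by exact: mxtameD.
have tD : mxtame E (fun w => D w : 'M[K]_n).
  by apply: mxtameD => //; exact: mxtameN.
have mS : measurable_fun setT S.
  by apply: measurable_herm => i j k; exact: (tS i j k).1.
pose G (A : 'M[K]_n) := sreal (-1) *: (A *m A) + sreal 2 *: A + (sreal 0)%:M.
(* Stated over any space, since it serves both for S on E and for the inclusion of [herm] into
   matrices over the empty set. *)
have tG d' (T' : measurableType d') (F : set T') f :
    mxtame F f -> mxtame F (G \o f).
  move=> tf; apply: mxtameD; last exact: mxtame_cst.
  by apply: mxtameD; apply: mxtameZ => //; exact: mxtameM.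
move=> i j k.
have tDD := mxtameM tD tD i j k.
have tGS := tG _ _ _ _ tS i j k.
split => //.
- exact: (tame_integrable mE PE tDD).
- exact: (tame_integrable mE PE tGS).
- have th : mxtame set0 (@herm_val R K n).
    by apply: mxtame_set0; exact: measurable_herm_coord.
  (* The preimage of B factors through S: it is the S-preimage of a measurable set of Hermitian
     matrices. *)
  move=> _ B mB; exists ((mx_coord i j k \o (G \o @herm_val R K n)) @^-1` B).
    by have := (tG _ _ _ _ th i j k).1 measurableT _ mB; rewrite setTI.
  by [].
- move=> _ [B mB <-]; have mSB := mS measurableT _ mB.
  apply: ae_eq_integral => //.
  + by apply/measurable_EFinP/measurable_funTS; exact: tGS.1.
  + by apply/measurable_EFinP/measurable_funTS; exact: tDD.1.
  + exists (~` E); split => //; first exact: measurableC.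
    (* By contraposition, the two integrands can differ only outside the almost sure event E. *)
    move=> w; apply: contra_not => -[pX pY] _; congr (_%:E).
    by congr (mx_coord i j k _); rewrite [RHS]projections_sqrB.
Qed.

End Bernoulli.

Theorem proposition3p1 (R : realType) (beta : dyson_index) (n : nat)
    (q : nat -> R) (mu : probability (herm (scalars R beta) n) R) :
  (1 <= n)%N ->
  bernoulli_ensemble q mu ->
  meixner_ensemble (-1) 2 0 mu.
Proof. by move=> _; exact: bernoulli_meixner. Qed.
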